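(* For each $n$ let $\mathcal{C},\mathcal{C}'$ be conjugacy classes of $S_n$ whose elements have $c_j$ (resp. $c'_j$) $j$-cycles. Let $\pi\in\mathcal{C}$, $\pi'\in\mathcal{C}'$ be independent and uniform, and let $N$ be the number of orbits of $\langle\pi,\pi'\rangle$ on $\{1,\dots,n\}$ of size $k$ with $1\leq k\leq n/2$. \begin{enumerate} \item If $c_1+c'_1=o(n^{2/3})$ and $(c_1+c_2^{1/2})(c'_1+{c'_2}^{1/2})=o(n)$, then $\mathbf{E} N=o(1)$. \item If $c_1+c'_1=O(n^{2/3})$, $(c_1+c_2^{1/2})(c'_1+{c'_2}^{1/2})=O(n)$, and there is a constant $\epsilon>0$ with $c_2+c'_2\leq(1-\epsilon)n$, then $\mathbf{E} N=O(1)$. \end{enumerate}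
   Context: Asymptotic notation is with respect to $n\to\infty$. *)

(* Defs.v *)
From HB Require Import structures.
From mathcomp Require Import all_boot all_order all_algebra all_fingroup.
From mathcomp Require Import all_classical all_reals all_analysis.
Set Implicit Arguments. Unset Strict Implicit. Unset Printing Implicit Defensive.
Import Order.TTheory GRing.Theory Num.Theory.
Local Open Scope ring_scope.

Definition cyc_count (n : nat) (s : 'S_n) (j : nat) : nat :=
  #|[set X in porbits s | #|X| == j]|.

(* c_j for a conjugacy class C (read off any element, e.g. its representative) *)
Definition class_cyc (n : nat) (C : {set 'S_n}) (j : nat) : nat :=
  cyc_count (repr C) j.

Definition small_orbits (n : nat) (s t : 'S_n) : nat :=
  #|[set O in orbit 'P <<[set s; t]>> @: [set: 'I_n]
     | (0 < #|O|)%N && (2 * #|O| <= n)%N]|.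

Definition expected_small_orbits (R : realType) (n : nat) (C C' : {set 'S_n}) : R :=
  (\sum_(s in C) \sum_(t in C') (small_orbits s t)%:R) / (#|C| * #|C'|)%:R.

Definition little_o (R : realType) (f g : nat -> R) : Prop :=
  forall eps : R, 0 < eps -> exists N0 : nat, forall n, (N0 <= n)%N -> `|f n| <= eps * `|g n|.
Definition big_O (R : realType) (f g : nat -> R) : Prop :=
  exists K : R, 0 < K /\ exists N0 : nat, forall n, (N0 <= n)%N -> `|f n| <= K * `|g n|.

(* Main.v *)
Require Import Defs.
From HB Require Import structures.
From mathcomp Require Import all_boot all_order all_algebra all_fingroup.
From mathcomp Require Import primitive_action alt.
From mathcomp Require Import all_classical all_reals all_analysis.
From mathcomp Require Import ring lra.
Import Order.TTheory GRing.Theory Num.Theory.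
Local Open Scope ring_scope.

(** An orbit of [<s, t>] is a set fixed by both [s] and [t], so by transitivity of
    [S_n] on [k]-sets the expected number of orbits of size [k] is at most
    [p_k p'_k / 'C(n, k)], where [p_k], [p'_k] count the [k]-sets fixed by an element
    of each class. Here [p_k] is the [x^k]-coefficient of [prod_j (1 + x^j)^(c_j)],
    hence at most [x^(-k)] times this product for every [x > 0].
    For [k] larger than a small multiple of [n] one takes [x = y = sqrt (k / (n - k))];
    the gain over ['C(n, k)] is exponential in [n - c_2 - c'_2 >= eps n].
    For smaller [k] one takes [x y = k / n], tilted towards the class with fewer fixed
    points, and gets an exponential decay in [k]. This proves (2); for (1) the
    terms with bounded [k] are moreover each [o(1)], by the choice
    [x = 1 / (c_1 + sqrt c_2 + n^(1/3))], [y = 1 / (c'_1 + sqrt c'_2 + n^(1/3))]. *)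

Set Implicit Arguments.
Unset Strict Implicit.

(** * Counting fixed sets *)

Definition fixed_sets {T : finType} (s : {perm T}) (k : nat) : {set {set T}} :=
  [set A : {set T} | (#|A| == k) && (s @: A == A)].

Lemma perm_imset_conj (T : finType) (s g : {perm T}) (A : {set T}) :
  ((s ^ g)%g @: (g @: A) == g @: A) = (s @: A == A).
Proof.
have -> : (s ^ g)%g @: (g @: A) = g @: (s @: A).
  rewrite -!imset_comp; apply: eq_imset => x /=.
  by rewrite permJ.
by rewrite (inj_eq (imset_inj perm_inj)).
Qed.

(** The symmetric group is transitive on tuples of [#|A|] distinct points; this is applied to the
    enumerations of [A] and [B]. *)
Lemma perm_imset_onto (T : finType) (A B : {set T}) :
  #|A| = #|B| -> exists g : {perm T}, g @: A = B.
Proof.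
move=> eqAB.
have szA : size (enum A) == #|A| by rewrite -cardE.
have szB : size (enum B) == #|A| by rewrite -cardE eqAB.
have dt (S : {set T}) (szS : size (enum S) == #|A|) :
    Tuple szS \in dtuple_on #|A| [set: T].
  by rewrite inE enum_uniq; apply/fintype.subsetP => x _; rewrite inE.
have /atransP2 tr : ntransitive #|A| 'Sym_T [set: T] 'P%act.
  exact: (ntransitive_weak (max_card _) (Sym_trans T)).
have [g _ /(congr1 val)/= eqg] := tr _ _ (dt A szA) (dt B szB).
exists g; apply/setP => y; rewrite -[RHS]mem_enum eqg.
by apply/imsetP/mapP => -[x xA ->]; exists x; rewrite ?mem_enum // -mem_enum.
Qed.

Lemma card_fixed_sets_conj (T : finType) (s g : {perm T}) k :
  #|fixed_sets (s ^ g)%g k| = #|fixed_sets s k|.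
Proof.
rewrite -(card_imset (mem (fixed_sets s k)) (imset_inj (@perm_inj _ g))).
congr #|pred_of_set _|; apply/setP => B; apply/idP/imsetP => [|[A]].
  rewrite inE => /andP[/eqP cB sB].
  have gB : B = g @: (g^-1%g @: B).
    rewrite -imset_comp -[LHS]imset_id; apply: eq_imset => x /=.
    by rewrite permKV.
  exists (g^-1%g @: B) => //.
  rewrite inE card_imset ?cB ?eqxx //=; last exact: perm_inj.
  by rewrite -(@perm_imset_conj _ _ g) -gB.
rewrite inE => /andP[/eqP cA sA] ->.
by rewrite inE perm_imset_conj sA card_imset ?cA ?eqxx //; exact: perm_inj.
Qed.

Lemma partition_porbits (T : finType) (s : {perm T}) :
  finset.partition (porbits s) [set: T].
Proof.
have -> : porbits s = orbit 'P%act <[s]> @: [set: T].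
  by apply/setP => X; apply/imsetP/imsetP => -[x _ ->]; exists x;
    rewrite ?inE // porbit.unlock.
apply: orbit_partition.
by apply/actsP => g _ x; rewrite !inE.
Qed.

(** An invariant set contains the whole cycle of each of its points, so it is determined by the
    cycles inside it. *)
Lemma cover_porbits_fixed (T : finType) (s : {perm T}) (A : {set T}) :
  s @: A = A -> finset.cover [set X in porbits s | X \subset A] = A.
Proof.
move=> sA; apply/setP => x; apply/bigcupP/idP => [[X]|xA].
  by rewrite inE => /andP[_ /fintype.subsetP XA] /XA.
exists (porbit s x); last exact: porbit_id.
rewrite inE imset_f //=; apply/fintype.subsetP => _ /porbitP[i ->].
elim: i => [|i IH]; first by rewrite expg0 perm1.
by rewrite expgSr permM -sA imset_f.
Qed.

(* Expanding the product over the cycles of [s], every [s]-invariant set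
   contributes the monomial of the set of cycles it contains. *)
Lemma fixed_sets_le_prod (R : realDomainType) (T : finType) (s : {perm T}) k (x : R) :
  0 <= x ->
  #|fixed_sets s k|%:R * x ^+ k <= \prod_(X in porbits s) (1 + x ^+ #|X|).
Proof.
move=> x0; set P := porbits s.
(* Extension by [0] outside the cycles lets the product run over all sets, the form in which it can
   be expanded by [bigA_distr]. *)
pose F (X : {set T}) := if X \in P then x ^+ #|X| else 0.
have F0 X : 0 <= F X by rewrite /F; case: ifP => // _; rewrite exprn_ge0.
have -> : \prod_(X in P) (1 + x ^+ #|X|) = \prod_X (F X + 1).
  rewrite [RHS](bigID (mem P)) /= [X in _ * X]big1 ?mulr1.
    by apply: eq_bigr => X XP; rewrite /F XP addrC.
  by move=> X /negPf XP; rewrite /F XP add0r.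
rewrite bigA_distr.
pose J (A : {set T}) := [set X in P | X \subset A].
have injJ : {in fixed_sets s k &, injective J}.
  move=> A B; rewrite !inE => /andP[_ /eqP sA] /andP[_ /eqP sB] eqJ.
  by rewrite -(cover_porbits_fixed sA) -(cover_porbits_fixed sB) -/(J A) eqJ.
rewrite (bigID (mem (J @: fixed_sets s k))) /=.
apply: ler_wpDr.
  by apply: sumr_ge0 => K _; apply: prodr_ge0 => X _; case: ifP.
rewrite big_imset //= mulr_natl -sumr_const; apply: ler_sum => A.
rewrite inE => /andP[/eqP cA /eqP sA].
have pJ : finset.partition (J A) A.
  rewrite /finset.partition cover_porbits_fixed // eqxx /=.
  have /and3P[_ tP P0] := partition_porbits s.
  apply/andP; split; first by apply: finset.trivIsetS tP; apply/fintype.subsetP=> X; rewrite inE => /andP[].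
  by rewrite inE (negPf P0).
rewrite -big_mkcond /= -cA (card_partition pJ) expr_sum le_eqVlt; apply/orP; left.
by apply/eqP/eq_bigr => X; rewrite inE /F => /andP[->].
Qed.

Lemma cyc_countE (n : nat) (s : 'S_n) (j : nat) :
  (\sum_(X in porbits s) (#|X| == j) = cyc_count s j)%N.
Proof.
rewrite /cyc_count -sum1_card big_mkcond [RHS]big_mkcond /=.
by apply: eq_bigr => X _; rewrite inE; case: (X \in _) => //=; case: eqP.
Qed.

Lemma sum_card_porbits (n : nat) (s : 'S_n) : (\sum_(X in porbits s) #|X| = n)%N.
Proof. by rewrite -(card_partition (partition_porbits s)) cardsT card_ord. Qed.

Lemma porbits_card_gt0 (T : finType) (s : {perm T}) X : X \in porbits s -> (0 < #|X|)%N.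
Proof. by case/imsetP => x _ ->; rewrite lt0n card_porbit_neq0. Qed.

Lemma cyc_count2_le (n : nat) (s : 'S_n) : (2 * cyc_count s 2 <= n)%N.
Proof.
rewrite -{2}(sum_card_porbits s) -cyc_countE big_distrr /=.
by apply: leq_sum => X _; case: eqP => [->|].
Qed.

(** Every point is charged [d], with a surcharge [a] per fixed point and [b] per 2-cycle. A cycle of
    length [j >= 3] needs no surcharge, since [1 + x ^+ j <= 1 + x ^+ 3] and [3 * d <= j * d]. *)
Lemma fixed_sets_le_expR (R : realType) (n : nat) (s : 'S_n) k (x a b d : R) :
  0 <= x -> x <= 1 -> 1 + x <= expR (a + d) -> 1 + x ^+ 2 <= expR (b + 2 * d) ->
  1 + x ^+ 3 <= expR (3 * d) ->
  #|fixed_sets s k|%:R * x ^+ k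
    <= expR (a * (cyc_count s 1)%:R + b * (cyc_count s 2)%:R + d * n%:R).
Proof.
move=> x0 x1 h1 h2 h3; apply: le_trans (fixed_sets_le_prod _ _ _) _ => //.
have d0 : 0 <= d.
  rewrite -(pmulr_rge0 d (_ : 0 < 3)) // -ler_expR expR0 (le_trans _ h3)//.
  by rewrite lerDl exprn_ge0.
have -> : a * (cyc_count s 1)%:R + b * (cyc_count s 2)%:R + d * n%:R =
  \sum_(X in porbits s) (a * (#|X| == 1)%N%:R + b * (#|X| == 2)%N%:R + d * #|X|%:R).
  rewrite !big_split /= -!mulr_sumr -!natr_sum.
  by rewrite -(cyc_countE s 1) -(cyc_countE s 2) sum_card_porbits.
rewrite expR_sum; apply: ler_prod => X /porbits_card_gt0 X0.
rewrite addr_ge0 ?exprn_ge0 //=.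
case: #|X| X0 => [|[|[|j]]] //= _; rewrite ?mulr0 ?mulr1 ?addr0 ?add0r //.
  by rewrite (mulrC d).
apply: le_trans (_ : expR (3 * d) <= _).
  apply: le_trans h3; rewrite lerD2l -addn3 exprD ler_piMl ?exprn_ge0 //.
  by rewrite exprn_ile1.
by rewrite ler_expR mulrC ler_wpM2l // ler_nat.
Qed.

(** * From orbits to fixed sets, and their expected number *)

Lemma small_orbits_le (n : nat) (s t : 'S_n) :
  (small_orbits s t <= \sum_(1 <= k < n./2.+1) #|fixed_sets s k :&: fixed_sets t k|)%N.
Proof.
rewrite /small_orbits; set O := [set _ in _ | _].
have -> : #|O| = (\sum_(1 <= k < n./2.+1) #|[set X in O | #|X| == k]|)%N.
  rewrite -sum1_card.
  transitivity (\sum_(X in O) \sum_(1 <= k < n./2.+1) (#|X| == k))%N.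
    apply: eq_bigr => X; rewrite inE => /andP[_ /andP[X0 X2]].
    rewrite (bigD1_seq #|X|) ?iota_uniq //=; last first.
      by rewrite mem_index_iota X0 ltnS geq_half_double -mul2n.
    by rewrite eqxx big1 // => i /negPf; rewrite eq_sym => ->.
  rewrite exchange_big; apply: eq_bigr => k _ /=.
  rewrite -sum1_card [RHS]big_mkcond [LHS]big_mkcond /=; apply: eq_bigr => X _.
  by rewrite [in RHS]inE; case: (X \in O); case: eqP.
apply: leq_sum => k _; apply: subset_leq_card; apply/fintype.subsetP => X.
rewrite !inE => /andP[/andP[/imsetP[x _ ->] _] ->] /=.
(* An orbit is invariant under the whole group, in particular under both generators. *)
have fixP (g : 'S_n) : g \in <<[set s; t]>>%g ->
    g @: orbit 'P <<[set s; t]>> x == orbit 'P <<[set s; t]>> x.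
  move=> gG; rewrite eqEcard card_imset ?leqnn ?andbT; last exact: perm_inj.
  apply/fintype.subsetP => _ /imsetP[y yO ->].
  by apply: (@orbit_trans _ _ 'P%act <<[set s; t]>>%G) yO; exact: mem_orbit.
by rewrite !fixP ?mem_gen // !inE eqxx ?orbT.
Qed.

Definition class_fixing {T : finType} (C : {set {perm T}}) (A : {set T}) : nat := #|[set s in C | s @: A == A]|.

(** Conjugation by a permutation carrying [A] to [B] maps [C] to itself and exchanges the two
    stabilisers. *)
Lemma class_fixing_card (T : finType) (C : {set {perm T}}) (A B : {set T}) :
  C \in classes [set: {perm T}] -> #|A| = #|B| ->
  class_fixing C A = class_fixing C B.
Proof.
move=> /imsetP[s0 _ eC] /perm_imset_onto[g <-].
have CJ s h : s \in C -> (s ^ h)%g \in C.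
  by rewrite eC => /imsetP[r _ ->]; rewrite -conjgM imset_f ?inE.
rewrite /class_fixing -(card_imset (mem [set s in C | s @: A == A]) (@conjg_inj _ g)).
congr #|pred_of_set _|; apply/setP => s; apply/imsetP/idP => [[r]|].
  by rewrite !inE => /andP[rC rA] ->; rewrite perm_imset_conj rA CJ.
rewrite inE => /andP[sC sA]; exists (s ^ g^-1)%g; last by rewrite conjgKV.
by rewrite inE CJ //= -(@perm_imset_conj _ _ g) conjgKV.
Qed.

(** Double counting of the pairs of an element of [C] and a [k]-set fixed by it; conjugate elements
    fix equally many [k]-sets. *)
Lemma sum_class_fixing (T : finType) (C : {set {perm T}}) k :
  C \in classes [set: {perm T}] ->
  (\sum_(A : {set T} | #|A| == k) class_fixing C A = #|C| * #|fixed_sets (repr C) k|)%N.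
Proof.
move=> hC; transitivity (\sum_(s in C) #|fixed_sets s k|)%N.
  rewrite (eq_bigr (fun A : {set T} => \sum_(s in C) (s @: A == A)))%N; last first.
    move=> A _; rewrite /class_fixing -sum1_card [LHS]big_mkcond [RHS]big_mkcond /=.
    by apply: eq_bigr => s _; rewrite inE; case: (s \in C); case: eqP.
  rewrite exchange_big; apply: eq_bigr => s _ /=.
  rewrite -sum1_card [LHS]big_mkcond [RHS]big_mkcond /=.
  by apply: eq_bigr => A _; rewrite inE; case: eqP; case: eqP.
rewrite -sum_nat_const; apply: eq_bigr => s sC.
case/imsetP: hC => s0 _ eC.
have : repr C \in C by apply: mem_repr sC.
rewrite {2}eC => /imsetP[g _ ->]; move: sC; rewrite eC => /imsetP[h _ ->].
by rewrite (card_fixed_sets_conj s0 h) (card_fixed_sets_conj s0 g).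
Qed.

(** By independence, the number of pairs fixing a given [k]-set is a product of two counts, each
    depending only on [k]. Each count comes from the double counting above; the equation is
    multiplied out to stay in [nat]. *)
Lemma expected_fixed_sets (n : nat) (C C' : {set 'S_n}) k :
  C \in classes [set: 'S_n] -> C' \in classes [set: 'S_n] -> (k <= n)%N ->
  ('C(n, k) * \sum_(s in C) \sum_(t in C') #|fixed_sets s k :&: fixed_sets t k|
   = #|C| * #|C'| * (#|fixed_sets (repr C) k| * #|fixed_sets (repr C') k|))%N.
Proof.
move=> hC hC' kn.
have -> : (\sum_(s in C) \sum_(t in C') #|fixed_sets s k :&: fixed_sets t k|
  = \sum_(A : {set 'I_n} | #|A| == k) class_fixing C A * class_fixing C' A)%N.
  transitivity (\sum_(s in C) \sum_(t in C') \sum_(A : {set 'I_n} | #|A| == k)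
     (s @: A == A) * (t @: A == A))%N.
    apply: eq_bigr => s _; apply: eq_bigr => t _.
    rewrite -sum1_card [LHS]big_mkcond [RHS]big_mkcond /=.
    by apply: eq_bigr => A _; rewrite !inE; case: eqP; case: eqP; case: eqP.
  under eq_bigr do rewrite exchange_big /=.
  rewrite exchange_big; apply: eq_bigr => A _ /=.
  under eq_bigr do rewrite -big_distrr /=.
  rewrite -big_distrl /=; congr (_ * _)%N;
  by rewrite /class_fixing -sum1_card [LHS]big_mkcond [RHS]big_mkcond /=;
    apply: eq_bigr => s _; rewrite inE; case: (s \in _); case: eqP.
have [A0 cA0] : exists A : {set 'I_n}, #|A| = k.
  exists [set i : 'I_n | (i < k)%N].
  rewrite -sum1_card (eq_bigl (fun i : 'I_n => (i < k)%N)); last by move=> i; rewrite inE.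
  by rewrite -(big_ord_widen _ (fun=> 1%N)) // sum1_card card_ord.
have E D : D \in classes [set: 'S_n] ->
    (#|D| * #|fixed_sets (repr D) k| = 'C(n, k) * class_fixing D A0)%N.
  move=> hD; rewrite -sum_class_fixing //.
  rewrite (eq_bigr (fun=> class_fixing D A0)).
    by rewrite sum_nat_const -cardsE card_draws card_ord.
  by move=> A /eqP cA; apply: class_fixing_card; rewrite ?cA.
rewrite mulnACA !E // (eq_bigr (fun=> class_fixing C A0 * class_fixing C' A0)%N).
  by rewrite sum_nat_const -cardsE card_draws card_ord mulnACA -!mulnA.
move=> A /eqP cA.
by rewrite (@class_fixing_card _ C A A0) ?(@class_fixing_card _ C' A A0) ?cA.
Qed.

Lemma expected_small_orbits_le (R : realType) (n : nat) (C C' : {set 'S_n}) :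
  C \in classes [set: 'S_n] -> C' \in classes [set: 'S_n] ->
  expected_small_orbits R C C' <=
  \sum_(1 <= k < n./2.+1)
    #|fixed_sets (repr C) k|%:R * #|fixed_sets (repr C') k|%:R / 'C(n, k)%:R.
Proof.
move=> hC hC'; rewrite /expected_small_orbits.
have C0 D : D \in classes [set: 'S_n] -> (0 < #|D|)%N.
  by case/imsetP=> s _ ->; apply/card_gt0P; exists s; exact: class_refl.
have CC0 : 0 < (#|C| * #|C'|)%:R :> R by rewrite ltr0n muln_gt0 !C0.
rewrite ler_pdivrMr // mulr_suml.
have -> : \sum_(1 <= k < n./2.+1)
    #|fixed_sets (repr C) k|%:R * #|fixed_sets (repr C') k|%:R / 'C(n, k)%:R
      * (#|C| * #|C'|)%:R = (\sum_(1 <= k < n./2.+1)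
   \sum_(s in C) \sum_(t in C') #|fixed_sets s k :&: fixed_sets t k|)%N%:R :> R.
  rewrite natr_sum !big_nat; apply: eq_bigr => k /andP[_ kn].
  have kn' : (k <= n)%N.
    by rewrite -ltnS (leq_trans kn) // ltnS -{2}(odd_double_half n) -addnn addnCA leq_addr.
  have b0 : 'C(n, k)%:R != 0 :> R by rewrite pnatr_eq0 -lt0n bin_gt0.
  apply: (mulfI b0); rewrite -[RHS]natrM expected_fixed_sets // !natrM.
  by field.
have -> : \sum_(s in C) \sum_(t in C') (small_orbits s t)%:R =
    (\sum_(s in C) \sum_(t in C') small_orbits s t)%N%:R :> R.
  by rewrite natr_sum; apply: eq_bigr => s _; rewrite natr_sum.
rewrite ler_nat [leqRHS]exchange_big; apply: leq_sum => s _ /=.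
by rewrite [leqRHS]exchange_big; apply: leq_sum => t _ /=; exact: small_orbits_le.
Qed.

(** * Estimates *)

Lemma expr_le_fact_expR (R : realType) (n : nat) :
  n%:R ^+ n <= n`!%:R * expR n%:R :> R.
Proof.
elim: n => [|n IH]; first by rewrite expr0 expR0 mulr1.
case: n IH => [|n] IH.
  by rewrite expr1 mul1r (le_trans _ (expR_ge1Dx _)) // lerDr.
have n0 : 0 < n.+1%:R :> R by [].
(* This is [(1 + 1/m)^m <= e], the ratio of consecutive terms in the induction. *)
have h : (n.+2%:R / n.+1%:R) ^+ n.+1 <= expR 1 :> R.
  have -> : expR 1 = expR n.+1%:R^-1 ^+ n.+1 :> R by rewrite -expRM_natl mulfV ?gt_eqF.
  rewrite lerXn2r ?nnegrE ?divr_ge0 ?expR_ge0 //.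
  apply: le_trans (expR_ge1Dx _).
  by rewrite -(natr1 n.+1) mulrDl mulfV ?gt_eqF // mul1r.
rewrite expr_div_n ler_pdivrMr ?exprn_gt0 // in h.
rewrite exprS factS natrM -(natr1 n.+1) expRD natr1 -!mulrA ler_pM2l //.
apply: le_trans h _; rewrite mulrC mulrA ler_wpM2r ?expR_ge0 //.
Qed.

Lemma fact_expR_le (R : realType) (k : nat) : (0 < k)%N ->
  k`!%:R * expR k%:R <= expR 1 * k%:R * k%:R ^+ k :> R.
Proof.
case: k => // k _; elim: k => [|k IH].
  by rewrite expr1 mul1r !mulr1.
have h : expR 1 * k.+1%:R ^+ k.+2 <= k.+2%:R ^+ k.+2 :> R.
  (* This is [(1 - 1/m)^m <= 1/e] with [m = k + 2]. *)
  have e1 : (k.+1%:R / k.+2%:R) ^+ k.+2 <= expR (-1) :> R.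
    have -> : expR (-1) = expR (- k.+2%:R^-1) ^+ k.+2 :> R.
      by rewrite -expRM_natl mulrN mulfV ?gt_eqF.
    rewrite lerXn2r ?nnegrE ?divr_ge0 ?expR_ge0 //.
    apply: le_trans (expR_ge1Dx _).
    by rewrite -{1}(addrK 1 k.+1%:R) natr1 mulrBl mulfV ?gt_eqF // mul1r.
  rewrite expr_div_n ler_pdivrMr ?exprn_gt0 // in e1.
  have := ler_wpM2l (expR_ge0 1) e1.
  by rewrite [leRHS]mulrA expRxMexpNx_1 mul1r.
rewrite factS natrM -(natr1 k.+1) expRD natr1.
have -> : k.+2%:R * k.+1`!%:R * (expR k.+1%:R * expR 1) =
  k.+2%:R * expR 1 * (k.+1`!%:R * expR k.+1%:R) :> R by ring.
apply: le_trans (ler_wpM2l _ IH) _; first by rewrite mulr_ge0 ?expR_ge0.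
have -> : k.+2%:R * expR 1 * (expR 1 * k.+1%:R * k.+1%:R ^+ k.+1) =
  expR 1 * k.+2%:R * (expR 1 * k.+1%:R ^+ k.+2) :> R by rewrite (exprS _ k.+1); ring.
by rewrite ler_wpM2l // mulr_ge0 ?expR_ge0.
Qed.

Lemma expn_le_ffact (n k j : nat) : (j <= k)%N -> ((n - k) ^ j <= n ^_ j)%N.
Proof.
elim: j => [|j IH] jk; first by rewrite expn0 ffactn0.
by rewrite expnSr ffactnSr leq_mul ?IH ?leq_sub2l // ltnW.
Qed.

(** The falling factorial is at least [(n - k)^k], and [k!] is at most [e k (k/e)^k]. This loses
    little when [k / n] is small. *)
Lemma bin_ge (R : realType) (n k : nat) : (0 < k)%N ->
  (n - k)%:R ^+ k * expR k%:R <= 'C(n, k)%:R * (expR 1 * k%:R * k%:R ^+ k) :> R.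
Proof.
move=> k0; apply: le_trans (ler_wpM2l _ (fact_expR_le _ k0)) => //.
by rewrite mulrA -natrM bin_ffact ler_wpM2r ?expR_ge0 // -natrX ler_nat expn_le_ffact.
Qed.

(** Stirling-type bounds for all three factorials of [n! = 'C(n, k) k! (n - k)!]. Only a polynomial
    factor is lost, so this serves [k] proportional to [n]. *)
Lemma bin_ge_entropy (R : realType) (n k : nat) : (0 < k < n)%N ->
  n%:R ^+ n <= 'C(n, k)%:R * (expR 1 * k%:R * k%:R ^+ k)
    * (expR 1 * (n - k)%:R * (n - k)%:R ^+ (n - k)) :> R.
Proof.
move=> /andP[k0 kn]; apply: le_trans (expr_le_fact_expR _ _) _.
have nk0 : (0 < n - k)%N by rewrite subn_gt0.
rewrite -(bin_fact (ltnW kn)) -{3}(subnKC (ltnW kn)) natrD expRD !natrM.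
have -> : 'C(n, k)%:R * (k`!%:R * (n - k)`!%:R) * (expR k%:R * expR (n - k)%:R)
  = 'C(n, k)%:R * (k`!%:R * expR k%:R) * ((n - k)`!%:R * expR (n - k)%:R) :> R by ring.
apply: ler_pM; rewrite ?mulr_ge0 ?expR_ge0 ?fact_expR_le //.
by rewrite ler_wpM2l ?fact_expR_le.
Qed.

(* The weights are [x = u^3 / r], [y = u^3 * r] with [u = (k/n)^(1/6)] and
   [w = n^(1/6)], where the tilt [r] is [1] unless [c1] is much larger than
   [sqrt n = w^3], in which case [r = min (c1 / (5 K w^3), 1 / u)]. *)
Lemma saddle_weights (R : realFieldType) (K eps u w c1 c2 d1 q : R) :
  0 < K -> eps <= 1 / 10 -> 0 < u -> u <= 1 -> 0 < w -> 1 <= w * u ->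
  0 <= c1 -> 0 <= c2 -> 0 <= d1 -> 0 <= q -> d1 <= c1 -> c1 <= K * w ^+ 4 ->
  c1 * d1 <= K * w ^+ 6 -> c1 * q <= K * w ^+ 6 ->
  c2 + q ^+ 2 <= (1 - eps) * w ^+ 6 -> 2 * c2 <= w ^+ 6 ->
  exists x y : R, [/\ 0 < x <= 1, 0 < y <= 1, x * y = u ^+ 6 &
    (c1 * x + c2 * x ^+ 2 + x ^+ 3 / 3 * w ^+ 6)
    + (d1 * y + q ^+ 2 * y ^+ 2 + y ^+ 3 / 3 * w ^+ 6)
    <= (1 - eps) * (w * u) ^+ 6 + 2 / 3 * u ^+ 3 * (w * u) ^+ 6
       + (10 * K + 1) * (w * u) ^+ 4].
Proof.
move=> K0 e1 u0 u1 w0 v1 c10 c20 d10 q0 dc c1K cdK cqK c2q c2w.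
have v0 : 0 < w * u by rewrite mulr_gt0.
have v34 : (w * u) ^+ 3 <= (w * u) ^+ 4 by apply: ler_weXn2l.
have uX m : 0 < u ^+ m by apply: exprn_gt0.
have wX m : 0 < w ^+ m by apply: exprn_gt0.
have uX1 m : u ^+ m <= 1 by apply: exprn_ile1 => //; apply: ltW.
have c2u : c2 * u ^+ 6 <= (w * u) ^+ 6 / 2.
  rewrite exprMn [leRHS]mulrAC ler_wpM2r ?(ltW (uX _)) //; lra.
(* No tilt: both fixed-point terms are within the allowed [(w * u) ^+ 4], and the hypothesis on
   2-cycles applies with equal weights. *)
have [c1w|c1w] := leP c1 (5 * K * w ^+ 3).
  exists (u ^+ 3), (u ^+ 3); rewrite !uX !uX1; split => //; first by ring.
  have h1 : (c1 + d1) * u ^+ 3 <= 10 * K * (w * u) ^+ 4.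
    apply: le_trans (_ : 10 * K * (w * u) ^+ 3 <= _); last first.
      by rewrite ler_wpM2l // mulr_ge0 // ltW.
    rewrite exprMn [leRHS]mulrA ler_wpM2r ?(ltW (uX _)) //; lra.
  have h2 : (c2 + q ^+ 2) * u ^+ 6 <= (1 - eps) * (w * u) ^+ 6.
    by rewrite exprMn [leRHS]mulrA ler_wpM2r ?(ltW (uX _)).
  have v4 : 0 <= (w * u) ^+ 4 by rewrite exprn_ge0 // ltW.
  have -> : (c1 * u ^+ 3 + c2 * u ^+ 3 ^+ 2 + u ^+ 3 ^+ 3 / 3 * w ^+ 6)
    + (d1 * u ^+ 3 + q ^+ 2 * u ^+ 3 ^+ 2 + u ^+ 3 ^+ 3 / 3 * w ^+ 6)
    = (c1 + d1) * u ^+ 3 + (c2 + q ^+ 2) * u ^+ 6 + 2 / 3 * u ^+ 3 * (w * u) ^+ 6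
    by field.
  lra.
have v60 : 0 <= (w * u) ^+ 6 by rewrite exprn_ge0 // ltW.
have v40 : 0 <= (w * u) ^+ 4 by rewrite exprn_ge0 // ltW.
have KM0 : 0 < 5 * K * w ^+ 3 by rewrite !mulr_gt0.
have c1p : 0 < c1 by apply: lt_trans c1w.
have uv0 : 0 <= u ^+ 3 * (w * u) ^+ 6 by rewrite mulr_ge0 // exprn_ge0 // ltW.
have eps6 : (9 / 10) * (w * u) ^+ 6 <= (1 - eps) * (w * u) ^+ 6.
  by rewrite ler_wpM2r //; lra.
(* When there is a tilt, the 2-cycles and the cubic term of [y] cost at most
   [1/2 + 1/25 + 1/3 < 9/10] times [(w * u) ^+ 6], which is where [eps <= 1 / 10] enters. *)
suff [x [y [xP yP xy [c1x d1y xu yu qy]]]] : exists x y : R,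
    [/\ 0 < x <= 1, 0 < y <= 1, x * y = u ^+ 6 &
     [/\ c1 * x <= 5 * K * (w * u) ^+ 4, d1 * y <= (w * u) ^+ 4 / 5, x <= u ^+ 3,
         y <= u ^+ 2 & q * y <= (w * u) ^+ 3 / 5]].
  exists x, y; split => //.
  have [[x0 x1] [y0 y1]] := (andP xP, andP yP).
  have x2 : c2 * x ^+ 2 <= (w * u) ^+ 6 / 2.
    apply: le_trans c2u; rewrite ler_wpM2l // (_ : u ^+ 6 = u ^+ 3 ^+ 2); last by ring.
    by rewrite lerXn2r // nnegrE ltW.
  have x3 : x ^+ 3 / 3 * w ^+ 6 <= u ^+ 3 * (w * u) ^+ 6 / 3.
    have -> : u ^+ 3 * (w * u) ^+ 6 / 3 = u ^+ 3 ^+ 3 / 3 * w ^+ 6 by field.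
    rewrite ler_wpM2r ?(ltW (wX _)) // ler_wpM2r //.
    by rewrite lerXn2r // nnegrE ltW.
  have y2 : q ^+ 2 * y ^+ 2 <= (w * u) ^+ 6 / 25.
    have -> : (w * u) ^+ 6 / 25 = ((w * u) ^+ 3 / 5) ^+ 2 by field.
    rewrite -exprMn lerXn2r // nnegrE.
      by rewrite mulr_ge0 // ltW.
    by rewrite mulr_ge0 // exprn_ge0 // ltW.
  have y3 : y ^+ 3 / 3 * w ^+ 6 <= (w * u) ^+ 6 / 3.
    have -> : (w * u) ^+ 6 / 3 = u ^+ 2 ^+ 3 / 3 * w ^+ 6 by field.
    rewrite ler_wpM2r ?(ltW (wX _)) // ler_wpM2r //.
    by rewrite lerXn2r // nnegrE ltW.
  have Kv4 : 0 <= K * (w * u) ^+ 4 by rewrite mulr_ge0 // ltW.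
  lra.
have cdw : d1 <= K * w ^+ 6 / c1 by rewrite ler_pdivlMr // mulrC.
have cqw : q <= K * w ^+ 6 / c1 by rewrite ler_pdivlMr // mulrC.
(* The tilt [c1 / (5 K w^3)] is used as long as it is at most [1 / u]; beyond that it is capped,
   giving [x = u^4] and [y = u^2]. *)
have [c1wu|c1wu] := leP c1 (5 * K * w ^+ 3 / u).
  pose r := c1 / (5 * K * w ^+ 3).
  have r0 : 0 < r by rewrite divr_gt0.
  have r1 : 1 <= r by rewrite ler_pdivlMr ?mul1r // ltW.
  have ru : r * u <= 1.
    by rewrite /r mulrAC ler_pdivrMr // mul1r -ler_pdivlMr.
  have rw : c1 = r * (5 * K * w ^+ 3) by rewrite /r divfK // gt_eqF.
  have dr m : m <= K * w ^+ 6 / c1 -> m * (u ^+ 3 * r) <= (w * u) ^+ 3 / 5.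
    move=> h; apply: le_trans (ler_wpM2r _ h) _; first by rewrite mulr_ge0 // ltW.
    rewrite rw le_eqVlt; apply/orP; left; apply/eqP; field.
    by rewrite !gt_eqF.
  have xu : u ^+ 3 / r <= u ^+ 3 by rewrite ler_pdivrMr // ler_peMr // ltW.
  have yu : u ^+ 3 * r <= u ^+ 2.
    by rewrite exprSr -mulrA ler_piMr ?(ltW (uX _)) // mulrC.
  exists (u ^+ 3 / r), (u ^+ 3 * r); split.
  - by rewrite divr_gt0 //= (le_trans xu).
  - by rewrite mulr_gt0 //= (le_trans yu).
  - by field; rewrite gt_eqF.
  - split => //; last exact: dr.
    + have -> : c1 * (u ^+ 3 / r) = 5 * K * (w * u) ^+ 3.
        by rewrite {1}rw; field; rewrite gt_eqF.
      by rewrite ler_wpM2l // mulr_ge0 // ltW.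
    + by apply: le_trans (dr _ cdw) _; rewrite ler_wpM2r.
have dr m : m <= K * w ^+ 6 / c1 -> m * u ^+ 2 <= (w * u) ^+ 3 / 5.
  move=> h; apply: le_trans (ler_wpM2r (ltW (uX _)) h) _.
  have {}h : K * w ^+ 6 / c1 <= w ^+ 3 * u / 5.
    rewrite ler_pdivrMr //.
    have -> : K * w ^+ 6 = w ^+ 3 * u / 5 * (5 * K * w ^+ 3 / u).
      by field; rewrite gt_eqF.
    by rewrite ler_wpM2l ?(ltW c1wu) // !mulr_ge0 ?ltW.
  apply: le_trans (ler_wpM2r (ltW (uX _)) h) _.
  by rewrite le_eqVlt; apply/orP; left; apply/eqP; field.
exists (u ^+ 4), (u ^+ 2); rewrite !uX !uX1; split => //; first by ring.
split => //; last exact: dr.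
- rewrite exprMn [leRHS]mulrA ler_wpM2r ?(ltW (uX _)) //; apply: le_trans c1K _.
  by rewrite ler_wpM2r ?(ltW (wX _)) //; lra.
- by apply: le_trans (dr _ cdw) _; rewrite ler_wpM2r.
- by apply: ler_wiXn2l => //; apply: ltW.
Qed.

(** * Orbit sizes up to a small multiple of [n] *)

Lemma half_range (n k : nat) : (0 < k)%N -> (2 * k <= n)%N ->
  [/\ (k < n)%N, (0 < n)%N, (0 < n - k)%N & (k <= n - k)%N].
Proof.
move=> k0; rewrite mul2n -addnn => kn.
have kn' : (k < n)%N by rewrite (leq_trans _ kn) // -{1}[k]addn0 ltn_add2l.
by split => //; rewrite ?subn_gt0 // ?(leq_trans k0 (ltnW kn')) // leq_subRL // ltnW.
Qed.

(** Errors of order [k^(2/3)] or [n^(2/3)] are absorbed into a small linear term plus a constant.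
    The two cases meet at [v ^+ 2 = D / del]. *)
Lemma quartic_absorb (R : realFieldType) (D del v : R) : 0 <= D -> 0 < del -> 0 <= v ->
  D * v ^+ 4 <= del * v ^+ 6 + D ^+ 3 / del ^+ 2.
Proof.
move=> D0 del0 v0; have [h|h] := leP (v ^+ 2) (D / del).
  apply: ler_wpDl; first by rewrite mulr_ge0 ?exprn_ge0 // ltW.
  have -> : D ^+ 3 / del ^+ 2 = D * (D / del) ^+ 2 by field; rewrite gt_eqF.
  have -> : v ^+ 4 = v ^+ 2 ^+ 2 by ring.
  by rewrite ler_wpM2l // lerXn2r // nnegrE ?exprn_ge0 // divr_ge0 // ltW.
apply: ler_wpDr; first by rewrite divr_ge0 ?exprn_ge0 // ltW.
rewrite ltr_pdivrMr // in h.
have -> : del * v ^+ 6 = v ^+ 2 * del * v ^+ 4 by ring.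
by rewrite ler_wpM2r ?exprn_ge0 // ltW.
Qed.

(* Abstracts the cycle structure of a permutation of [n] points to what the
   estimates need: [F] is its number of fixed [k]-sets, and [c1], [c2] are its
   numbers of fixed points and of 2-cycles. *)
Definition cycle_bound (R : realType) (n k : nat) (F c1 c2 : R) : Prop :=
  forall x a b d : R, 0 <= x -> x <= 1 -> 1 + x <= expR (a + d) ->
    1 + x ^+ 2 <= expR (b + 2 * d) -> 1 + x ^+ 3 <= expR (3 * d) ->
    F * x ^+ k <= expR (a * c1 + b * c2 + d * n%:R).

(** The choice [a = x], [b = x^2], [d = x^3 / 3], by [1 + t <= exp t]. *)
Lemma cycle_bound_cubic (R : realType) (n k : nat) (F c1 c2 x : R) :
  cycle_bound n k F c1 c2 -> 0 <= x -> x <= 1 ->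
  F * x ^+ k <= expR (c1 * x + c2 * x ^+ 2 + x ^+ 3 / 3 * n%:R).
Proof.
move=> hF x0 x1; have x30 : 0 <= x ^+ 3 by rewrite exprn_ge0.
rewrite (mulrC c1) (mulrC c2); apply: hF => //.
- by apply: le_trans (expR_ge1Dx _) _; rewrite ler_expR; lra.
- by apply: le_trans (expR_ge1Dx _) _; rewrite ler_expR; lra.
- by apply: le_trans (expR_ge1Dx _) _; rewrite ler_expR; lra.
Qed.

(** The hypotheses of (2) with [w = n^(1/6)], for classes with [c1], [d1] fixed points and [c2],
    [d2] 2-cycles. The last two bounds hold for every permutation. *)
Definition admissible (R : realType) (K eps w c1 c2 d1 d2 : R) : Prop :=
  [/\ c1 <= K * w ^+ 4, d1 <= K * w ^+ 4,
      (c1 + Num.sqrt c2) * (d1 + Num.sqrt d2) <= K * w ^+ 6,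
      c2 + d2 <= (1 - eps) * w ^+ 6 & 2 * c2 <= w ^+ 6 /\ 2 * d2 <= w ^+ 6].

Lemma admissible_sym (R : realType) (K eps w c1 c2 d1 d2 : R) :
  admissible K eps w c1 c2 d1 d2 -> admissible K eps w d1 d2 c1 c2.
Proof.
by case=> h1 h2 h3 h4 [h5 h6]; split; rewrite // [leLHS](mulrC, addrC).
Qed.

(** By symmetry the second class has fewer fixed points, so that the tilted weights of
    [saddle_weights] apply; their product is [u ^+ 6]. *)
Lemma fixed_sets_product_le (R : realType) (K eps u w c1 c2 d1 d2 F F' : R) (n k : nat) :
  0 < K -> 0 < eps -> eps <= 1 / 10 -> 0 < u -> u <= 1 -> 0 < w -> 1 <= w * u ->
  w ^+ 6 = n%:R ->
  0 <= c1 -> 0 <= c2 -> 0 <= d1 -> 0 <= d2 -> 0 <= F -> 0 <= F' ->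
  cycle_bound n k F c1 c2 -> cycle_bound n k F' d1 d2 ->
  admissible K eps w c1 c2 d1 d2 ->
  F * F' * (u ^+ 6) ^+ k <= expR ((1 - eps) * (w * u) ^+ 6
     + 2 / 3 * u ^+ 3 * (w * u) ^+ 6 + (10 * K + 1) * (w * u) ^+ 4).
Proof.
move=> K0 e0 e1 u0 u1 w0 v1 wn.
wlog dc : c1 c2 d1 d2 F F' / d1 <= c1.
  move=> W c10 c20 d10 d20 F0 F'0 hF hF' adm; have [dc|/ltW dc] := leP d1 c1; first exact: (W c1 c2 d1 d2).
  by rewrite (mulrC F); apply: (W d1 d2 c1 c2) => //; exact: admissible_sym.
move=> c10 c20 d10 d20 F0 F'0 hF hF' [h1 h2 h3 h4 [h5 h6]].
have q0 : 0 <= Num.sqrt d2 by rewrite sqrtr_ge0.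
have s0 : 0 <= Num.sqrt c2 by rewrite sqrtr_ge0.
have [||||x [y [/andP[x0 x1] /andP[y0 y1] xy E]]] :=
   @saddle_weights _ K eps u w c1 c2 d1 (Num.sqrt d2) K0 e1 u0 u1 w0 v1 c10 c20 d10 q0 dc h1.
- apply: le_trans h3; rewrite mulrDl !mulrDr -!addrA lerDl.
  by rewrite !addr_ge0 ?mulr_ge0.
- apply: le_trans h3; rewrite mulrDl !mulrDr [X in _ <= X + _]addrC -!addrA lerDl.
  by rewrite !addr_ge0 ?mulr_ge0.
- by rewrite sqr_sqrtr.
- by [].
apply: le_trans (_ : expR _ <= _); last by rewrite ler_expR; exact: E.
rewrite -xy exprMn expRD mulrACA wn sqr_sqrtr //; apply: ler_pM.
- by rewrite mulr_ge0 // exprn_ge0 // ltW.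
- by rewrite mulr_ge0 // exprn_ge0 // ltW.
- by apply: cycle_bound_cubic => //; exact: ltW.
- by apply: cycle_bound_cubic => //; exact: ltW.
Qed.

(** The fixed sets contribute [exp ((1 - eps) k)] and the binomial coefficient [exp (- k)], up to
    errors. In units of [eps k] these are [1/12] (cubic term), [1/4] (replacing [n - k] by [n]),
    [1/8] (quartic term) and [1/8] (the factor [k]), which leaves more than [1/4] of decay. *)
Lemma tail_small (R : realType) (K eps u w c1 c2 d1 d2 F F' : R) (n k : nat) :
  0 < K -> 0 < eps -> eps <= 1 / 10 -> (0 < k)%N -> (2 * k <= n)%N ->
  0 < u -> u ^+ 3 <= eps / 8 -> 0 < w -> w ^+ 6 = n%:R -> (w * u) ^+ 6 = k%:R ->
  0 <= c1 -> 0 <= c2 -> 0 <= d1 -> 0 <= d2 -> 0 <= F -> 0 <= F' ->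
  cycle_bound n k F c1 c2 -> cycle_bound n k F' d1 d2 ->
  admissible K eps w c1 c2 d1 d2 ->
  F * F' / 'C(n, k)%:R <=
    expR 1 * (8 / eps) * expR ((10 * K + 1) ^+ 3 / (eps / 8) ^+ 2) * expR (- (eps / 4 * k%:R)).
Proof.
move=> K0 e0 e1 k0 kn u0 ue w0 wn wuk c10 c20 d10 d20 F0 F'0 hF hF' adm.
have [kn' n0N m0N km] := half_range k0 kn.
have v0 : 0 < w * u by rewrite mulr_gt0.
have kR : 1 <= k%:R :> R by rewrite ler1n.
have u1 : u <= 1.
  by rewrite -(@expr_le1 _ 3) ?ltW //; lra.
have v1 : 1 <= w * u by rewrite -(@expr_ge1 _ 6) ?wuk // ltW.
have := fixed_sets_product_le K0 e0 e1 u0 u1 w0 v1 wn c10 c20 d10 d20 F0 F'0 hF hF' adm.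
set E := expR _ => FE.
have n0 : 0 < n%:R :> R by rewrite ltr0n.
have m0 : 0 < (n - k)%:R :> R by rewrite ltr0n.
have t1 : n%:R * u ^+ 6 = k%:R by rewrite -wuk -wn exprMn.
have nm : n%:R <= (n - k)%:R * expR (2 * u ^+ 6).
  apply: le_trans (_ : (n - k)%:R * (1 + 2 * u ^+ 6) <= _); last first.
    by rewrite ler_wpM2l // expR_ge1Dx.
  have : 2 * u ^+ 6 <= 1.
    have -> : u ^+ 6 = u ^+ 3 * u ^+ 3 by ring.
    have : u ^+ 3 * u ^+ 3 <= 1 / 80 * 1.
      by apply: ler_pM; rewrite ?exprn_ge0 ?(ltW u0) //; lra.
    lra.
  rewrite natrB ?(ltnW kn') //.
  have : 0 <= u ^+ 6 by rewrite exprn_ge0 // ltW.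
  have := t1; nra.
have b0 : 0 < 'C(n, k)%:R :> R by rewrite ltr0n bin_gt0 ltnW.
have kk0 : 0 < k%:R ^+ k :> R by rewrite exprn_gt0 // ltr0n.
have main : F * F' / 'C(n, k)%:R <=
    E * (expR 1 * k%:R) * expR (- k%:R) * expR (2 * u ^+ 6 * k%:R).
  rewrite ler_pdivrMr //.
  rewrite -(ler_pM2r kk0) -(ler_pM2r (_ : 0 < (n - k)%:R ^+ k)) ?exprn_gt0 //.
  have A : F * F' * k%:R ^+ k <= E * n%:R ^+ k.
    have -> : F * F' * k%:R ^+ k = F * F' * (u ^+ 6) ^+ k * n%:R ^+ k.
      by rewrite -t1 exprMn; ring.
    by rewrite ler_wpM2r // exprn_ge0.
  have B : n%:R ^+ k <= (n - k)%:R ^+ k * expR (2 * u ^+ 6 * k%:R).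
    by rewrite expRM_natr -exprMn lerXn2r ?nnegrE ?mulr_ge0 ?expR_ge0.
  have C := bin_ge R n k0.
  have e0' : 0 <= E by rewrite expR_ge0.
  apply: le_trans (_ : E * ((n - k)%:R ^+ k * expR (2 * u ^+ 6 * k%:R)) * (n - k)%:R ^+ k <= _).
    rewrite ler_wpM2r ?exprn_ge0 //; apply: le_trans A _; by rewrite ler_wpM2l.
  have C' : (n - k)%:R ^+ k <= 'C(n, k)%:R * (expR 1 * k%:R * k%:R ^+ k) * expR (- k%:R) :> R.
    by rewrite expRN ler_pdivlMr ?expR_gt0.
  apply: le_trans (_ : E * ((n - k)%:R ^+ k * expR (2 * u ^+ 6 * k%:R)) *
     ('C(n, k)%:R * (expR 1 * k%:R * k%:R ^+ k) * expR (- k%:R)) <= _).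
    by rewrite ler_wpM2l // !mulr_ge0 ?expR_ge0 ?exprn_ge0.
  by rewrite le_eqVlt; apply/orP; left; apply/eqP; ring.
apply: le_trans main _.
have kexp : k%:R <= 8 / eps * expR (eps / 8 * k%:R).
  have h := expR_ge1Dx (eps / 8 * k%:R).
  apply: le_trans (_ : 8 / eps * (eps / 8 * k%:R) <= _).
    by rewrite le_eqVlt; apply/orP; left; apply/eqP; field; rewrite gt_eqF.
  rewrite ler_wpM2l ?divr_ge0 ?ltW //; lra.
have q4 := quartic_absorb (_ : 0 <= 10 * K + 1) (_ : 0 < eps / 8) (ltW v0).
apply: le_trans (_ : E * (expR 1 * (8 / eps * expR (eps / 8 * k%:R))) * expR (- k%:R)
   * expR (2 * u ^+ 6 * k%:R) <= _).
  rewrite ler_wpM2r ?expR_ge0 // ler_wpM2r ?expR_ge0 // ler_wpM2l ?expR_ge0 //.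
  by rewrite ler_wpM2l ?expR_ge0.
have -> : E * (expR 1 * (8 / eps * expR (eps / 8 * k%:R))) * expR (- k%:R)
   * expR (2 * u ^+ 6 * k%:R) = expR 1 * (8 / eps) *
   (E * expR (eps / 8 * k%:R) * expR (- k%:R) * expR (2 * u ^+ 6 * k%:R)) by ring.
rewrite -[leRHS]mulrA ler_wpM2l ?mulr_ge0 ?expR_ge0 ?invr_ge0 ?(ltW e0) //.
rewrite /E -!expRD ler_expR wuk.
have {}q4 : (10 * K + 1) * (w * u) ^+ 4 <= eps / 8 * k%:R + (10 * K + 1) ^+ 3 / (eps / 8) ^+ 2.
  by rewrite -wuk; apply: q4; lra.
have h1 : 2 / 3 * u ^+ 3 * k%:R <= eps / 12 * k%:R.
  by rewrite ler_wpM2r //; lra.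
have h2 : 2 * u ^+ 6 * k%:R <= eps / 4 * k%:R.
  rewrite ler_wpM2r //.
  have -> : u ^+ 6 = u ^+ 3 * u ^+ 3 by ring.
  have : u ^+ 3 * u ^+ 3 <= eps / 8 * 1.
    have u30 : 0 <= u ^+ 3 by rewrite exprn_ge0 // ltW.
    by apply: ler_pM => //; rewrite exprn_ile1 // ltW.
  lra.
have h3 : 0 <= eps * k%:R by rewrite mulr_ge0 // ltW.
lra.
Qed.

(** * Orbit sizes proportional to [n] *)

(** Per point, a 3-cycle contributes less than a 2-cycle, by a definite factor. After
    [(1 + s^2)^3 <= 8] the difference is [s^2 ((1 - s)^2 + 2 s^2)]. *)
Lemma large_weights (R : realFieldType) (s : R) : 0 <= s -> s <= 1 ->
  (1 + s ^+ 3) ^+ 2 <= (1 + s ^+ 2) ^+ 3 * (1 - s ^+ 2 / 4).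
Proof.
move=> s0 s1.
have s2 : 0 <= s ^+ 2 by rewrite exprn_ge0.
have s21 : s ^+ 2 <= 1 by rewrite exprn_ile1.
have h : (1 + s ^+ 2) ^+ 3 <= 8.
  have -> : 8 = 2 ^+ 3 :> R by ring.
  by rewrite lerXn2r ?nnegrE //; lra.
have h2 : s ^+ 2 / 4 * (1 + s ^+ 2) ^+ 3 <= s ^+ 2 / 4 * 8 by rewrite ler_wpM2l //; lra.
have h3 : 0 <= s ^+ 2 * ((1 - s) ^+ 2 + 2 * s ^+ 2).
  by rewrite mulr_ge0 // addr_ge0 ?sqr_ge0 // mulr_ge0.
have -> : (1 + s ^+ 3) ^+ 2 = (1 + s ^+ 2) ^+ 3 - s ^+ 2 / 4 * 8
   - s ^+ 2 * ((1 - s) ^+ 2 + 2 * s ^+ 2) by field.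
lra.
Qed.

(** With [x = y = s] and [z = s^2 = k / (n - k)], the bound [(1 + z)^n / z^k] equals
    [n^n / (k^k (n - k)^(n - k))] and cancels against [bin_ge_entropy]. Of the saving [4 gam n], one
    [gam n] pays for the factor [n^2] and one for the fixed points. *)
Lemma tail_large (R : realType) (K eps eta gam w c1 c2 d1 d2 F F' : R) (n k : nat) :
  0 < K -> 0 < eps -> eps <= 1 / 10 -> (0 < k)%N -> (2 * k <= n)%N ->
  0 < eta -> eta * eps = 4 * gam -> 12 * eta * n%:R <= k%:R -> 0 < w -> w ^+ 6 = n%:R ->
  0 <= c1 -> 0 <= c2 -> 0 <= d1 -> 0 <= d2 -> 0 <= F -> 0 <= F' ->
  cycle_bound n k F c1 c2 -> cycle_bound n k F' d1 d2 ->
  admissible K eps w c1 c2 d1 d2 ->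
  F * F' / 'C(n, k)%:R <=
    expR 1 ^+ 2 * (2 / gam ^+ 2) * expR ((2 * K) ^+ 3 / gam ^+ 2) * expR (- (2 * gam * k%:R)).
Proof.
move=> K0 e0 e1 k0 kn eta0 h4 etan w0 wn c10 c20 d10 d20 F0 F'0 hF hF' [a1 a2 _ a4 _].
have gam0 : 0 < gam by rewrite -(pmulr_rgt0 _ (_ : 0 < 4)) // -h4 mulr_gt0.
have [kn' n0N m0N km] := half_range k0 kn.
have n0 : 0 < n%:R :> R by rewrite ltr0n.
have m0 : 0 < (n - k)%:R :> R by rewrite ltr0n.
have kR : 0 < k%:R :> R by rewrite ltr0n.
have mk : (n - k)%:R = n%:R - k%:R :> R by rewrite natrB // ltnW.
have kmR : k%:R <= (n - k)%:R :> R by rewrite ler_nat.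
pose z : R := k%:R / (n - k)%:R.
have z0 : 0 < z by rewrite divr_gt0.
have z1 : z <= 1 by rewrite ler_pdivrMr // mul1r.
have zeta : 12 * eta <= z.
  rewrite ler_pdivlMr // mk; apply: le_trans etan; rewrite ler_wpM2l //; lra.
have zn : 1 + z = n%:R / (n - k)%:R by rewrite /z mk; field; rewrite -mk gt_eqF.
pose s := Num.sqrt z.
have s2 : s ^+ 2 = z by rewrite sqr_sqrtr // ltW.
have s0 : 0 <= s by rewrite sqrtr_ge0.
have s1 : s <= 1 by rewrite -(@expr_le1 _ 2) // s2.
have z10 : 0 < 1 + z by lra.
(* Each point saves [eta / 2], and each 2-cycle returns [eta]. Over both permutations the net saving
   is [eta (n - c2 - d2) >= eta eps n]. *)
pose d := (ln (1 + z) - eta) / 2.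
have h3 : 1 + s ^+ 3 <= expR (3 * d).
  rewrite -(@ler_pXn2r _ 2) ?nnegrE ?addr_ge0 ?exprn_ge0 ?expR_ge0 //.
  apply: le_trans (large_weights s0 s1) _; rewrite s2.
  rewrite -expRM_natl (_ : 2%:R * (3 * d) = 3%:R * ln (1 + z) - 3 * eta); last by rewrite /d; field.
  rewrite expRD expRM_natl lnK ?posrE // ler_wpM2l ?exprn_ge0 ?(ltW z10) //.
  (* Here [12 * eta <= z] is used: [1 - z / 4 <= 1 - 3 * eta]. *)
  by apply: le_trans (expR_ge1Dx _); lra.
have d0 : 0 <= d.
  rewrite -(pmulr_rge0 d (_ : 0 < 3)) // -ler_expR expR0 (le_trans _ h3)//.
  by rewrite lerDl exprn_ge0.
have h2 : 1 + s ^+ 2 <= expR (eta + 2 * d).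
  have -> : eta + 2 * d = ln (1 + z) by rewrite /d; field.
  by rewrite lnK ?posrE // s2.
have h1 : 1 + s <= expR (1 + d).
  by apply: le_trans (expR_ge1Dx _); lra.
have PF := hF _ _ _ _ s0 s1 h1 h2 h3.
have PF' := hF' _ _ _ _ s0 s1 h1 h2 h3.
pose X := expR (2 * K * w ^+ 4 - eta * eps * n%:R).
have FX : F * F' * z ^+ k <= X * (1 + z) ^+ n.
  have -> : F * F' * z ^+ k = (F * s ^+ k) * (F' * s ^+ k).
    by rewrite -s2 expr2 exprMn; ring.
  apply: le_trans (ler_pM _ _ PF PF') _; rewrite ?mulr_ge0 ?exprn_ge0 //.
  rewrite -(lnK (z10 : 1 + z \is Num.pos)) -expRM_natr -!expRD ler_expR.
  have -> : 1 * c1 + eta * c2 + d * n%:R + (1 * d1 + eta * d2 + d * n%:R)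
    = (c1 + d1) + eta * (c2 + d2) - eta * n%:R + ln (1 + z) * n%:R by rewrite /d; field.
  rewrite wn in a4; have := ler_wpM2l (ltW eta0) a4; lra.
have FX2 : F * F' * (k%:R ^+ k * (n - k)%:R ^+ (n - k)) <= X * n%:R ^+ n.
  have p0 : 0 < (n - k)%:R ^+ n :> R by rewrite exprn_gt0.
  have := ler_wpM2r (ltW p0) FX; rewrite zn /z !expr_div_n.
  congr (_ <= _); last by field; rewrite gt_eqF.
  rewrite -{3}(subnKC (ltnW kn')) exprD; field.
  by rewrite expf_neq0 // gt_eqF.
have b0 : 0 < 'C(n, k)%:R :> R by rewrite ltr0n bin_gt0 ltnW.
have X0 : 0 <= X by rewrite expR_ge0.
have G0 : 0 < k%:R ^+ k * (n - k)%:R ^+ (n - k) :> R by rewrite mulr_gt0 // exprn_gt0.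
have FX3 : F * F' / 'C(n, k)%:R <= X * (expR 1 ^+ 2 * n%:R ^+ 2).
  rewrite ler_pdivrMr // -(ler_pM2r G0); apply: le_trans FX2 _.
  have kn2 : (0 < k < n)%N by rewrite k0.
  apply: le_trans (ler_wpM2l X0 (bin_ge_entropy R kn2)) _.
  have -> : X * ('C(n, k)%:R * (expR 1 * k%:R * k%:R ^+ k) *
       (expR 1 * (n - k)%:R * (n - k)%:R ^+ (n - k))) =
     X * expR 1 ^+ 2 * 'C(n, k)%:R * (k%:R ^+ k * (n - k)%:R ^+ (n - k)) * (k%:R * (n - k)%:R) by ring.
  have -> : X * (expR 1 ^+ 2 * n%:R ^+ 2) * 'C(n, k)%:R * (k%:R ^+ k * (n - k)%:R ^+ (n - k)) =
     X * expR 1 ^+ 2 * 'C(n, k)%:R * (k%:R ^+ k * (n - k)%:R ^+ (n - k)) * (n%:R * n%:R) by ring.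
  rewrite ler_wpM2l ?mulr_ge0 ?exprn_ge0 ?expR_ge0 ?(ltW G0) //.
  by apply: ler_pM => //; rewrite ler_nat ?leq_subr // ltnW.
apply: le_trans FX3 _.
have nexp : n%:R ^+ 2 <= 2 / gam ^+ 2 * expR (gam * n%:R).
  have gn0 : 0 <= gam * n%:R by rewrite mulr_ge0 // ltW.
  have := @expR_ge1Dxn _ (gam * n%:R) 1 gn0 => h.
  rewrite mulrAC ler_pdivlMr ?exprn_gt0 // -exprMn mulrC.
  move: h; rewrite (_ : 2`!%:R = 2 :> R) //.
  lra.
have q4 := quartic_absorb (_ : 0 <= 2 * K) gam0 (ltW w0).
apply: le_trans (_ : X * (expR 1 ^+ 2 * (2 / gam ^+ 2 * expR (gam * n%:R))) <= _).
  by rewrite ler_wpM2l // ler_wpM2l // exprn_ge0 // expR_ge0.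
have -> : X * (expR 1 ^+ 2 * (2 / gam ^+ 2 * expR (gam * n%:R))) =
  expR 1 ^+ 2 * (2 / gam ^+ 2) * (X * expR (gam * n%:R)) by ring.
rewrite -[leRHS]mulrA ler_wpM2l //.
  by rewrite !mulr_ge0 ?exprn_ge0 ?expR_ge0 ?invr_ge0 ?exprn_ge0 // ltW.
rewrite /X -!expRD ler_expR.
have {}q4 : 2 * K * w ^+ 4 <= gam * n%:R + (2 * K) ^+ 3 / gam ^+ 2.
  by rewrite -wn; apply: q4; lra.
have h5 : gam * k%:R <= gam * n%:R by rewrite ler_wpM2l ?(ltW gam0) // ler_nat ltnW.
rewrite h4; lra.
Qed.

(** * All orbit sizes together *)

(** Sixth roots turn the powers [n^(1/3)], [n^(1/2)] and [n^(2/3)] into integer powers. *)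
Lemma sixth_root (R : realType) (x : R) : 0 < x -> exists2 v : R, 0 < v & v ^+ 6 = x.
Proof.
move=> x0; exists (expR (ln x / 6)); first exact: expR_gt0.
by rewrite -expRM_natl mulrC divfK ?lnK ?posrE.
Qed.

Lemma tail_bound (R : realType) (K eps : R) : 0 < K -> 0 < eps -> eps <= 1 / 10 ->
  exists B th : R, [/\ 0 < B, 0 < th & forall (n k : nat) (w c1 c2 d1 d2 F F' : R),
    (0 < k)%N -> (2 * k <= n)%N -> 0 < w -> w ^+ 6 = n%:R ->
    0 <= c1 -> 0 <= c2 -> 0 <= d1 -> 0 <= d2 -> 0 <= F -> 0 <= F' ->
    cycle_bound n k F c1 c2 -> cycle_bound n k F' d1 d2 ->
    admissible K eps w c1 c2 d1 d2 ->
    F * F' / 'C(n, k)%:R <= B * expR (- (th * k%:R))].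
Proof.
move=> K0 e0 e1.
(* The two ranges meet at [k / n = (eps / 8)^2 = 12 * eta]. *)
pose eta := (eps / 8) ^+ 2 / 12; pose gam := eta * eps / 4.
have eta0 : 0 < eta by rewrite divr_gt0 // exprn_gt0 // divr_gt0.
have gam0 : 0 < gam by rewrite divr_gt0 // mulr_gt0.
pose B1 := expR 1 * (8 / eps) * expR ((10 * K + 1) ^+ 3 / (eps / 8) ^+ 2).
pose B2 := expR 1 ^+ 2 * (2 / gam ^+ 2) * expR ((2 * K) ^+ 3 / gam ^+ 2).
have B10 : 0 < B1 by rewrite !mulr_gt0 ?expR_gt0 ?invr_gt0.
have B20 : 0 < B2 by rewrite !mulr_gt0 ?expR_gt0 ?invr_gt0 ?exprn_gt0 ?expR_gt0.
exists (B1 + B2), (2 * gam); split; [exact: addr_gt0|exact: mulr_gt0|].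
move=> n k w c1 c2 d1 d2 F F' k0 kn w0 wn c10 c20 d10 d20 F0 F'0 hF hF' adm.
have [v v0 vk] : exists2 v : R, 0 < v & v ^+ 6 = k%:R by apply: sixth_root; rewrite ltr0n.
have wv : w * (v / w) = v by rewrite mulrC divfK // gt_eqF.
have u0 : 0 < v / w by rewrite divr_gt0.
have kR : 0 <= k%:R :> R by [].
have th_le : 2 * gam <= eps / 4.
  rewrite /gam /eta.
  have : (eps / 8) ^+ 2 <= 1 by rewrite exprn_ile1 ?divr_ge0 ?(ltW e0) //; lra.
  have : 0 <= (eps / 8) ^+ 2 by rewrite sqr_ge0.
  by move=> *; nra.
have [us|us] := leP ((v / w) ^+ 3) (eps / 8).
  apply: le_trans (tail_small K0 e0 e1 k0 kn u0 us w0 wn _ c10 c20 d10 d20 F0 F'0 hF hF' adm) _.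
    by rewrite wv.
  apply: ler_pM; rewrite ?expR_ge0 ?(ltW B10) //; first by rewrite lerDl ltW.
  by rewrite ler_expR lerN2 ler_wpM2r.
apply: le_trans (_ : B2 * expR (- (2 * gam * k%:R)) <= _); last first.
  by rewrite ler_wpM2r ?expR_ge0 // lerDr ltW.
apply: (tail_large (eta := eta) K0 e0 e1 k0 kn eta0 _ _ w0 wn c10 c20 d10 d20 F0 F'0 hF hF' adm).
  by rewrite /gam; field.
rewrite -vk -wn -wv exprMn mulrC /eta ler_wpM2l ?exprn_ge0 ?(ltW w0) //.
have -> : 12 * ((eps / 8) ^+ 2 / 12) = (eps / 8) ^+ 2 by field.
have -> : (v / w) ^+ 6 = (v / w) ^+ 3 ^+ 2 by rewrite -exprM.
by rewrite lerXn2r ?nnegrE ?(ltW us) // ?divr_ge0 ?exprn_ge0 ?(ltW u0) ?(ltW e0).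
Qed.

Lemma geometric_tail (R : realFieldType) (q : R) (M N : nat) : 0 <= q -> q < 1 ->
  \sum_(M <= k < N) q ^+ k <= q ^+ M / (1 - q).
Proof.
move=> q0 q1; have q1' : 0 < 1 - q by rewrite subr_gt0.
rewrite ler_pdivlMr // mulr_suml.
have [NM|MN] := leqP N M; first by rewrite big_geq // exprn_ge0.
rewrite (telescope_sumr_eq (fun k => - q ^+ k)); last 2 first.
- exact: ltnW.
- by move=> k _; rewrite exprS; ring.
by rewrite opprK addrC gerDl oppr_le0 exprn_ge0.
Qed.

(* For bounded [k] the weights are [x = 1 / (c1 + sqrt c2 + n^(1/3))] and its
   analogue [y], for which both exponents stay bounded. *)
Lemma bounded_orbit_size (R : realType) (n k : nat) (w c1 c2 d1 d2 F F' : R) :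
  (0 < k)%N -> (2 * k <= n)%N -> 1 <= w -> w ^+ 6 = n%:R ->
  0 <= c1 -> 0 <= c2 -> 0 <= d1 -> 0 <= d2 -> 0 <= F -> 0 <= F' ->
  cycle_bound n k F c1 c2 -> cycle_bound n k F' d1 d2 ->
  F * F' / 'C(n, k)%:R <= expR 6 * k`!%:R *
   (2 * ((c1 + Num.sqrt c2 + w ^+ 2) * (d1 + Num.sqrt d2 + w ^+ 2) / n%:R)) ^+ k.
Proof.
move=> k0 kn w1 wn c10 c20 d10 d20 F0 F'0 hF hF'.
have [kn' n0N m0N km] := half_range k0 kn.
have n0 : 0 < n%:R :> R by rewrite ltr0n.
(* With weight [1 / A], each of the three terms of the cubic exponent is at most [1]. *)
have one G a b : 0 <= a -> 0 <= b -> cycle_bound n k G a b ->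
    G <= expR 3 * (a + Num.sqrt b + w ^+ 2) ^+ k.
  move=> a0 b0 hG; set A := a + _ + _.
  have s0 := sqrtr_ge0 b.
  have w2 : 1 <= w ^+ 2 by rewrite exprn_ege1.
  have A1 : 1 <= A by rewrite /A; lra.
  have A0 : 0 < A by lra.
  have x0 : 0 <= A^-1 by rewrite invr_ge0 ltW.
  have x1 : A^-1 <= 1 by rewrite invf_le1.
  have := cycle_bound_cubic hG x0 x1; rewrite exprVn ler_pdivrMr ?exprn_gt0 // => h.
  apply: le_trans h _; rewrite ler_wpM2r ?exprn_ge0 ?(ltW A0) // ler_expR.
  have h1 : a / A <= 1 by rewrite ler_pdivrMr // mul1r /A; lra.
  have h2 : b * A^-1 ^+ 2 <= 1.
    rewrite -{1}(sqr_sqrtr b0) -exprMn exprn_ile1 // ?mulr_ge0 //.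
    by rewrite ler_pdivrMr // mul1r /A; lra.
  have h3 : A^-1 ^+ 3 / 3 * n%:R <= 1.
    have -> : A^-1 ^+ 3 / 3 * n%:R = (w ^+ 2 / A) ^+ 3 / 3.
      by rewrite -wn; ring.
    have : (w ^+ 2 / A) ^+ 3 <= 1.
      have w0 : 0 <= w by lra.
      apply: exprn_ile1; first by rewrite mulr_ge0 ?exprn_ge0.
      by rewrite ler_pdivrMr // mul1r /A; lra.
    lra.
  lra.
have C0 : 0 < 'C(n, k)%:R :> R by rewrite ltr0n bin_gt0 ltnW.
(* Here [n <= 2 (n - k)], since [k] is at most half of [n]. *)
have nk : n%:R ^+ k <= 'C(n, k)%:R * k`!%:R * 2 ^+ k :> R.
  have -> : 'C(n, k)%:R * k`!%:R * 2 ^+ k = ('C(n, k) * k`! * 2 ^ k)%N%:R :> R.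
    by rewrite !natrM natrX.
  rewrite -natrX ler_nat bin_ffact.
  apply: leq_trans (_ : ((n - k) * 2) ^ k <= _)%N; last first.
    by rewrite expnMn leq_mul2r expn_le_ffact ?orbT.
  by rewrite leq_exp2r // muln2 -addnn -{1}(subnK (ltnW kn')) leq_add2l.
have h := ler_pM F0 F'0 (one _ _ _ c10 c20 hF) (one _ _ _ d10 d20 hF').
rewrite ler_pdivrMr //; apply: le_trans h _.
set A := c1 + _ + _; set A' := d1 + _ + _.
have -> : expR 3 * A ^+ k * (expR 3 * A' ^+ k) = expR 6 * (A * A') ^+ k :> R.
  have -> : expR 6 = expR 3 * expR 3 :> R by rewrite -expRD; congr expR; ring.
  by rewrite exprMn; ring.
have AA0 : 0 <= A * A' by rewrite mulr_ge0 ?addr_ge0 ?sqrtr_ge0 ?sqr_ge0.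
have -> : expR 6 * k`!%:R * (2 * (A * A' / n%:R)) ^+ k * 'C(n, k)%:R =
   expR 6 * (A * A') ^+ k * ('C(n, k)%:R * k`!%:R * 2 ^+ k / n%:R ^+ k).
  by rewrite !exprMn exprVn; ring.
rewrite ler_peMr ?mulr_ge0 ?expR_ge0 ?exprn_ge0 //.
by rewrite ler_pdivlMr ?exprn_gt0 // mul1r.
Qed.

Lemma cycle_bound_fixed_sets (R : realType) (n k : nat) (s : 'S_n) :
  cycle_bound n k (#|fixed_sets s k|%:R : R) (cyc_count s 1)%:R (cyc_count s 2)%:R.
Proof. by move=> x a b d; exact: fixed_sets_le_expR. Qed.

Lemma half_bound (n k : nat) : (k < n./2.+1)%N -> (2 * k <= n)%N.
Proof. by rewrite ltnS geq_half_double mul2n. Qed.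

(** The constants do not depend on [n] or on the cutoff [M]. Part (2) takes [M = 1], with an empty
    sum; part (1) takes a large fixed [M]. *)
Lemma expected_small_orbits_tail (R : realType) (K eps : R) :
  0 < K -> 0 < eps -> eps <= 1 / 10 ->
  exists B th : R, [/\ 0 < B, 0 < th & forall (n M : nat) (C C' : {set 'S_n}) (w : R),
    C \in classes [set: 'S_n] -> C' \in classes [set: 'S_n] ->
    (0 < M <= n./2.+1)%N -> 0 < w -> w ^+ 6 = n%:R ->
    admissible K eps w (class_cyc C 1)%:R (class_cyc C 2)%:R
      (class_cyc C' 1)%:R (class_cyc C' 2)%:R ->
    expected_small_orbits R C C' <=
      \sum_(1 <= k < M)
        #|fixed_sets (repr C) k|%:R * #|fixed_sets (repr C') k|%:R / 'C(n, k)%:R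
      + B * expR (- th) ^+ M].
Proof.
move=> K0 e0 e1; have [B [th [B0 th0 tail]]] := tail_bound K0 e0 e1.
have q1 : expR (- th) < 1 by rewrite expR_lt1 oppr_lt0.
exists (B / (1 - expR (- th))), th; split => //; first by rewrite divr_gt0 // subr_gt0.
move=> n M C C' w hC hC' /andP[M0 Mn] w0 wn adm.
apply: le_trans (expected_small_orbits_le _ hC hC') _.
rewrite (big_cat_nat M0 Mn) /= lerD2l.
apply: le_trans (_ : \sum_(M <= k < n./2.+1) B * expR (- th) ^+ k <= _); last first.
  rewrite -mulr_sumr mulrAC -mulrA ler_wpM2l ?(ltW B0) //.
  by apply: geometric_tail => //; exact: expR_ge0.
rewrite !big_nat; apply: ler_sum => k /andP[Mk kn].
rewrite -expRM_natr mulNr; apply: (tail n k w) adm; rewrite ?half_bound //.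
- exact: leq_trans Mk.
- exact: cycle_bound_fixed_sets.
- exact: cycle_bound_fixed_sets.
Qed.

Lemma powR_two_thirds (R : realType) (w x : R) : 0 < w -> w ^+ 6 = x -> x `^ (2 / 3) = w ^+ 4.
Proof.
move=> w0 <-; rewrite -!powR_mulrn ?(ltW w0) // -powRrM.
by congr (_ `^ _); field.
Qed.

Lemma bounded_orbit_sum (R : realType) (n M : nat) (s t : 'S_n) (w del : R) :
  (M <= n./2.+1)%N -> 1 <= w -> 1 <= del * w -> w ^+ 6 = n%:R -> 10 * del <= 1 ->
  (cyc_count s 1)%:R + (cyc_count t 1)%:R <= del * w ^+ 4 ->
  ((cyc_count s 1)%:R + Num.sqrt (cyc_count s 2)%:R) *
    ((cyc_count t 1)%:R + Num.sqrt (cyc_count t 2)%:R) <= del * w ^+ 6 ->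
  \sum_(1 <= k < M) #|fixed_sets s k|%:R * #|fixed_sets t k|%:R / 'C(n, k)%:R
    <= M%:R * (expR 6 * M`!%:R * (10 * del)).
Proof.
move=> Mn w1 dw wn del1 h1 h2.
have w0 : 0 < w by lra.
have d0 : 0 < del by rewrite -(pmulr_lgt0 _ w0); lra.
have n0 : 0 < n%:R :> R by rewrite -wn exprn_gt0.
have sq (r : 'S_n) : Num.sqrt (cyc_count r 2)%:R <= w ^+ 3.
  rewrite -(ger0_norm (exprn_ge0 3 (ltW w0))) -sqrtr_sqr ler_sqrt ?sqr_ge0 //.
  by rewrite -exprM wn ler_nat (leq_trans _ (cyc_count2_le r)) // leq_pmull.
(* Expanding the product gives at most [del w^6 + del w^6 + 2 w^5 + w^4], which is at most
   [5 del w^6] because [1 <= del * w]. *)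
have L : 2 * (((cyc_count s 1)%:R + Num.sqrt (cyc_count s 2)%:R + w ^+ 2) *
   ((cyc_count t 1)%:R + Num.sqrt (cyc_count t 2)%:R + w ^+ 2) / n%:R) <= 10 * del.
  rewrite mulrA ler_pdivrMr // -wn.
  have := sq s; have := sq t.
  set p := Num.sqrt _ in h2 *; set q := Num.sqrt _ in h2 * => hp hq.
  have h3 : w ^+ 2 * ((cyc_count s 1)%:R + (cyc_count t 1)%:R + (p + q)) <=
      w ^+ 2 * (del * w ^+ 4 + 2 * w ^+ 3).
    by rewrite ler_wpM2l ?exprn_ge0 ?(ltW w0) //; lra.
  have h4 : w ^+ 5 * 1 <= w ^+ 5 * (del * w) by rewrite ler_wpM2l ?exprn_ge0 ?(ltW w0).
  have h5 : w ^+ 4 <= w ^+ 5 by rewrite ler_weXn2l.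
  lra.
apply: le_trans (_ : \sum_(1 <= k < M) (expR 6 * M`!%:R * (10 * del)) <= _); last first.
  rewrite sumr_const_nat -[leLHS]mulr_natl ler_wpM2r ?ler_nat ?leq_subr //.
  by rewrite !mulr_ge0 ?expR_ge0 // ltW.
rewrite !big_nat; apply: ler_sum => k /andP[k0 kM].
have kn : (2 * k <= n)%N by apply/half_bound/(leq_trans kM).
have := bounded_orbit_size k0 kn w1 wn (ler0n _ _) (ler0n _ _) (ler0n _ _) (ler0n _ _)
  (ler0n _ _) (ler0n _ _) (@cycle_bound_fixed_sets R n k s) (@cycle_bound_fixed_sets R n k t).
move=> /le_trans; apply.
set X := 2 * _ in L *.
have X0 : 0 <= X.
  by rewrite !mulr_ge0 ?addr_ge0 ?sqrtr_ge0 ?exprn_ge0 ?invr_ge0 // ltW.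
apply: ler_pM; rewrite ?mulr_ge0 ?expR_ge0 ?exprn_ge0 //.
  by rewrite ler_wpM2l ?expR_ge0 // ler_nat leq_fact // ltnW.
(* Since [X <= 1] and [k >= 1], the power [X ^+ k] is at most [X]. *)
apply: (le_trans _ (L)); rewrite -(prednK k0) exprS ler_piMr // exprn_ile1 //.
exact: le_trans L del1.
Qed.

(** * Asymptotics *)

Lemma expected_small_orbits_ge0 (R : realType) (n : nat) (C C' : {set 'S_n}) :
  0 <= expected_small_orbits R C C'.
Proof.
by rewrite divr_ge0 //; apply: sumr_ge0 => s _; apply: sumr_ge0.
Qed.

Lemma admissible_classes (R : realType) (n : nat) (C C' : {set 'S_n}) (K eps w : R) :
  0 < w -> w ^+ 6 = n%:R ->
  (class_cyc C 1)%:R + (class_cyc C' 1)%:R <= K * w ^+ 4 ->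
  ((class_cyc C 1)%:R + Num.sqrt (class_cyc C 2)%:R) *
    ((class_cyc C' 1)%:R + Num.sqrt (class_cyc C' 2)%:R) <= K * w ^+ 6 ->
  (class_cyc C 2)%:R + (class_cyc C' 2)%:R <= (1 - eps) * w ^+ 6 ->
  admissible K eps w (class_cyc C 1)%:R (class_cyc C 2)%:R
    (class_cyc C' 1)%:R (class_cyc C' 2)%:R.
Proof.
move=> w0 wn h1 h2 h3; split => //.
- by apply: le_trans h1; rewrite lerDl.
- by apply: le_trans h1; rewrite lerDr.
- by rewrite wn -!natrM !ler_nat /class_cyc !cyc_count2_le.
Qed.

(** In part (1) this supplies the bound on 2-cycles that part (2) assumes: if [x] and [y] are at
    most [P / 2] with a small product, they cannot both be near [P / 2]. Expanding
    [(P / 2 - x) (P / 2 - y) >= 0] gives [x + y <= 0.52 P]. *)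
Lemma two_cycles_le (R : realFieldType) (x y P : R) : 0 < P -> 0 <= x -> 0 <= y ->
  2 * x <= P -> 2 * y <= P -> x * y <= (P / 10) ^+ 2 -> x + y <= (1 - 1 / 10) * P.
Proof.
move=> P0 x0 y0 xP yP xy.
have h : 0 <= (P / 2 - x) * (P / 2 - y) by rewrite mulr_ge0 //; lra.
rewrite -(ler_pM2r P0).
have P2 : 0 <= P ^+ 2 by rewrite sqr_ge0.
have eh : (P / 2 - x) * (P / 2 - y) = P ^+ 2 / 4 - (x + y) * P / 2 + x * y by field.
have e : (P / 10) ^+ 2 = P ^+ 2 / 100 by field.
have -> : (1 - 1 / 10) * P * P = (1 - 1 / 10) * P ^+ 2 by ring.
rewrite eh in h; rewrite e in xy; lra.
Qed.

Unset Implicit Arguments.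

Theorem theorem3p5 (R : realType)
  (C C' : forall n : nat, {set 'S_n})
  (hC : forall n, C n \in classes [set: 'S_n])
  (hC' : forall n, C' n \in classes [set: 'S_n]) :
  let c := fun n j => ((class_cyc (C n) j)%:R : R) in
  let c' := fun n j => ((class_cyc (C' n) j)%:R : R) in
  let EN := fun n => expected_small_orbits R (C n) (C' n) in
  (little_o (fun n => c n 1%N + c' n 1%N) (fun n => (n%:R : R) `^ (2 / 3)) ->
   little_o (fun n => (c n 1%N + Num.sqrt (c n 2%N)) * (c' n 1%N + Num.sqrt (c' n 2%N)))
            (fun n => (n%:R : R)) ->
   little_o EN (fun _ => 1))
  /\
  (big_O (fun n => c n 1%N + c' n 1%N) (fun n => (n%:R : R) `^ (2 / 3)) ->
   big_O (fun n => (c n 1%N + Num.sqrt (c n 2%N)) * (c' n 1%N + Num.sqrt (c' n 2%N)))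
         (fun n => (n%:R : R)) ->
   (exists eps : R, 0 < eps /\ exists N0 : nat, forall n, (N0 <= n)%N ->
      c n 2%N + c' n 2%N <= (1 - eps) * n%:R) ->
   big_O EN (fun _ => 1)).
Proof.
move=> c c' EN.
have fixed_points_le K n (w : R) : 0 < w -> w ^+ 6 = n%:R ->
    `|c n 1%N + c' n 1%N| <= K * `|(n%:R : R) `^ (2 / 3)| ->
    c n 1%N + c' n 1%N <= K * w ^+ 4.
  move=> w0 wn; rewrite (powR_two_thirds w0 wn) (ger0_norm (exprn_ge0 4 (ltW w0))).
  by apply: le_trans; exact: ler_norm.
have products_le K n (w : R) : w ^+ 6 = n%:R ->
    `|(c n 1%N + Num.sqrt (c n 2%N)) * (c' n 1%N + Num.sqrt (c' n 2%N))| <= K * `|n%:R : R| ->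
    (c n 1%N + Num.sqrt (c n 2%N)) * (c' n 1%N + Num.sqrt (c' n 2%N)) <= K * w ^+ 6.
  by move=> ->; rewrite normr_nat; apply: le_trans; exact: ler_norm.
split=> [H1 H2 e e0|[K1 [K10 [N1 H1]]] [K2 [K20 [N2 H2]]] [eps [eps0 [N3 H3]]]].
  have e10 : 0 < 1 / 10 :> R by lra.
  have [B [th [B0 th0 tail]]] := expected_small_orbits_tail ltr01 e10 (lexx _).
  (* The cutoff makes the tail at most [e / 2], by [exp t >= t] at [t = th * M]. *)
  pose M := (Num.truncn (2 * B / (e * th))).+1.
  have M0 : 0 < M%:R :> R by [].
  have BM : B * expR (- th) ^+ M <= e / 2.
    rewrite -expRM_natr mulNr expRN ler_pdivrMr ?expR_gt0 //.
    have h := expR_ge1Dx (th * M%:R).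
    apply: le_trans (_ : e / 2 * (th * M%:R) <= _); last first.
      by rewrite ler_wpM2l ?divr_ge0 ?(ltW e0) //; lra.
    have := truncnS_gt (2 * B / (e * th)).
    rewrite ltr_pdivrMr ?mulr_gt0 // -/M; lra.
  pose X : R := M%:R * (expR 6 * M`!%:R * 10).
  have X0 : 0 < X by rewrite !mulr_gt0 ?expR_gt0 // ltr0n fact_gt0.
  (* The first bound gives admissibility with [eps = 1 / 10], the second makes the terms below the
     cutoff at most [e / 2] in total. *)
  pose del := Num.min (1 / 10) (e / (2 * X)).
  have d0 : 0 < del by rewrite lt_min e10 divr_gt0 ?mulr_gt0.
  have d1 : del <= 1 / 10 by rewrite ge_min lexx.
  have d2 : del <= e / (2 * X) by rewrite ge_min lexx orbT.
  have dX : X * del <= e / 2.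
    rewrite mulrC -ler_pdivlMr //; apply: le_trans d2 _.
    by rewrite le_eqVlt; apply/orP; left; apply/eqP; field; rewrite gt_eqF.
  have [N1 {}H1] := H1 _ d0; have [N2 {}H2] := H2 _ d0.
  (* The last two entries ensure that [M] is at most [n / 2] and that [n^(1/6) >= 1 / del]. *)
  exists (maxn (maxn N1 N2) (maxn M.*2 (Num.truncn (del^-1 ^+ 6)).+1)) => n.
  rewrite !geq_max => /andP[/andP[n1 n2] /andP[nM nd]].
  have n0 : 0 < n%:R :> R by rewrite ltr0n (leq_trans _ nM).
  have [w w0 wn] := sixth_root n0.
  have wd : 1 <= del * w.
    rewrite mulrC -ler_pdivrMr // mul1r -(@ler_pXn2r _ 6) ?nnegrE ?invr_ge0 ?(ltW d0) ?(ltW w0) //.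
    by rewrite wn (le_trans (ltW (truncnS_gt _))) // ler_nat.
  have w1 : 1 <= w.
    by apply: le_trans wd _; rewrite ler_piMl ?(ltW w0) //; lra.
  have P0 : 0 < w ^+ 6 by rewrite exprn_gt0.
  have {}H1 := fixed_points_le _ _ _ w0 wn (H1 n n1).
  have {}H2 := products_le _ _ _ wn (H2 n n2).
  have c2le (D : {set 'S_n}) : 2 * (class_cyc D 2)%:R <= w ^+ 6.
    by rewrite wn -natrM ler_nat cyc_count2_le.
  have cc : c n 2%N * c' n 2%N <= (w ^+ 6 / 10) ^+ 2.
    rewrite -(sqr_sqrtr (ler0n R _ : 0 <= c n 2%N)) -(sqr_sqrtr (ler0n R _ : 0 <= c' n 2%N)).
    have P10 : 0 <= w ^+ 6 / 10 by rewrite divr_ge0 ?(ltW P0).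
    rewrite -exprMn lerXn2r ?nnegrE ?(mulr_ge0 (sqrtr_ge0 _) (sqrtr_ge0 _)) //.
    apply: le_trans (_ : del * w ^+ 6 <= _); last by have := ler_wpM2r (ltW P0) d1; lra.
    by apply: le_trans H2; apply: ler_pM; rewrite ?sqrtr_ge0 // lerDr.
  have adm : admissible 1 (1 / 10) w (class_cyc (C n) 1)%:R (class_cyc (C n) 2)%:R
      (class_cyc (C' n) 1)%:R (class_cyc (C' n) 2)%:R.
    apply: admissible_classes => //.
    - by apply: le_trans H1 _; rewrite ler_wpM2r ?exprn_ge0 ?(ltW w0) //; lra.
    - by apply: le_trans H2 _; rewrite ler_wpM2r ?(ltW P0) //; lra.
    - by apply: two_cycles_le.
  have Mn : (M <= n./2.+1)%N by rewrite (leq_trans _ (leqnSn _)) // geq_half_double.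
  rewrite ger0_norm ?expected_small_orbits_ge0 // normr1 mulr1.
  apply: le_trans (tail _ M _ _ _ (hC n) (hC' n) _ w0 wn adm) _; first by rewrite Mn.
  have -> : e = e / 2 + e / 2 by field.
  apply: lerD => //; apply: le_trans dX.
  apply: le_trans (bounded_orbit_sum Mn w1 wd wn _ H1 H2) _; first by lra.
  by rewrite /X le_eqVlt; apply/orP; left; apply/eqP; ring.
(* Decreasing [eps] weakens the hypothesis on 2-cycles, so it may be capped at [1 / 10]. *)
have e10 : 0 < Num.min eps (1 / 10) by rewrite lt_min eps0; lra.
have e11 : Num.min eps (1 / 10) <= 1 / 10 by rewrite ge_min lexx orbT.
have [B [th [B0 th0 tail]]] := expected_small_orbits_tail (addr_gt0 K10 K20) e10 e11.
exists B; split => //; exists (maxn (maxn N1 N2) (maxn N3 1)) => n.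
rewrite !geq_max => /andP[/andP[n1 n2] /andP[n3 n0]].
have nR : 0 < n%:R :> R by rewrite ltr0n.
have [w w0 wn] := sixth_root nR.
rewrite ger0_norm ?expected_small_orbits_ge0 // normr1 mulr1.
apply: le_trans (tail _ 1%N _ _ _ (hC n) (hC' n) _ w0 wn _) _ => //.
  apply: admissible_classes => //.
  - apply: le_trans (fixed_points_le _ _ _ w0 wn (H1 n n1)) _.
    by rewrite ler_wpM2r ?exprn_ge0 ?(ltW w0) // lerDl ltW.
  - apply: le_trans (products_le _ _ _ wn (H2 n n2)) _.
    by rewrite ler_wpM2r ?exprn_ge0 ?(ltW w0) // lerDr ltW.
  - apply: le_trans (H3 n n3) _.
    by rewrite wn ler_wpM2r // lerD2l lerN2 ge_min lexx.
rewrite big_geq // add0r expr1 ler_piMr ?(ltW B0) //.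
by rewrite expR_le1 oppr_le0 ltW.
Qed.
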